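(* If two framed singular virtual strings are homotopic, then their singular based matrices are homologous (with respect to the framed moves $\hat M_1,\hat M_2,\hat M_3,\hat M_w$, their inverses, and the singularity switch $N$).
   Context: A framed singular virtual string is associated to a framed flat virtual knot diagram with exactly one (singular) double point. A flat virtual knot diagram is a generic immersed oriented closed plane curve whose double points are flat classical crossings or virtual crossings; here exactly one further crossing is marked as a singular double point. The associated singular virtual string is an oriented circle (core circle), parametrizing the curve, with one arrow (ordered pair of points: tail, head) for each flat classical crossing and for the double point, joining the two preimages and directed so that (tangent vector at the tail branch, tangent vector at the head branch) is a positively oriented basis of the plane; the arrow $d$ of the double point is the preferred arrow. Two framed singular virtual strings are homotopic if corresponding diagrams are related by planar isotopy, virtual and mixed Reidemeister moves, flat Reidemeister moves 2 and 3, the flat framed Reidemeister move 1 (inserting or removing on an arc two consecutive kinks, neither involving the double point), and the rigid vertex isotopy moves: sliding an arc (with flat classical or with virtual crossings) across the double point, and the move (s-ii) in which a double point followed by a flat classical crossing of the same two strands (forming a bigon) is replaced by the flat crossing followed by the double point. Flat Reidemeister 2 moves do not involve the double point. A singular based matrix (SBM) is a quadruple $(G,s,d,b)$ with $G$ a finite set, $s,d\in G$ distinct, and $b\colon G\times G\to\mathbb{Z}$ skew-symmetric. The SBM of a singular virtual string $\alpha$ has $G=\{s\}\sqcup\mathrm{arr}(\alpha)$ ($\mathrm{arr}(\alpha)$ the set of all arrows, including the preferred arrow $d$), and $b$ as follows. Write $xy$ for the oriented arc of the core circle from $x$ to $y$, $(xy)^\circ$ for its interior. For an arrow $e=(a,b)$,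 $b(e,s)$ is the number of arrows with tail in $(ab)^\circ$ and head in $(ba)^\circ$ minus the number with head in $(ab)^\circ$ and tail in $(ba)^\circ$. For arrows $e=(x,y)$, $f=(z,w)$, $b(e,f)=xy\cdot zw+\varepsilon$, where $xy\cdot zw$ is the number of arrows with tail in $(xy)^\circ$ and head in $(zw)^\circ$ minus the number with head in $(xy)^\circ$ and tail in $(zw)^\circ$, and $\varepsilon=1$ if $z\in(xy)^\circ$, $w\in(yx)^\circ$; $\varepsilon=-1$ if $z\in(yx)^\circ$, $w\in(xy)^\circ$; $\varepsilon=0$ otherwise. An element $g\in G\setminus\{s,d\}$ is annihilating if $b(g,h)=0$ for all $h$, and core if $b(g,h)=b(s,h)$ for all $h$; $g_1,g_2\in G\setminus\{s,d\}$ are complementary if $b(g_1,h)+b(g_2,h)=b(s,h)$ for all $h\in G$. Moves: $\hat M_1$ (resp. $\hat M_2$) adds two new elements to $G$, extending $b$ so that both are annihilating (resp. both core); $\hat M_3$ adds two new elements, extending $b$ to any skew-symmetric map in which they are complementary; $\hat M_w$ changes one annihilating element $g\in G\setminus\{s,d\}$ into a core element, leaving $b$ unchanged on pairs not involving $g$; the singularity switch $N$ changes $(G,s,d,b)$ into $(G,s,g,b)$ when $g\in G\setminus\{s,d\}$ satisfies $b(g,h)+b(d,h)=b(s,h)$ for all $h\in G$. Two SBMs are isomorphic if there is a bijection of underlying sets preserving $s$, $d$ and $b$, and homologous if they are related, up to isomorphism, by a finite sequence of these moves and their inverses. *)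

(* Defs.v *)
(** Framed singular virtual strings, their homotopy, and singular based
    matrices up to homology.  (MathComp world.) *)
From HB Require Import structures.
From Stdlib Require Import Relations.
From mathcomp Require Import all_boot all_order all_algebra.
From mathcomp Require Import zify.

Set Implicit Arguments.
Unset Strict Implicit.
Unset Printing Implicit Defensive.

Import GRing.Theory.

(** * Gauss words

    An oriented closed curve with labelled double points is recorded by the
    cyclic word of the double-point branches met along it, read from an
    arbitrary base point.  The letter [(c, true)] is the tail branch of [c] and
    [(c, false)] its head branch; in a plane curve these are named so that
    (tangent at the tail branch, tangent at the head branch) is a positive
    basis, i.e. the head branch crosses the tail branch from right to left. *)

Definition letter := (nat * bool)%type.
Definition word := seq letter.

Definition opp (l : letter) : letter := (l.1, ~~ l.2).

Definition gauss (w : word) : bool :=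
  uniq w && all (fun l => opp l \in w) w.

Definition labels (w : word) : seq nat := [seq l.1 | l <- w & l.2].

Definition relabel (f : nat -> nat) (l : letter) : letter := (f l.1, l.2).

(** [w'] is [w] with labels renamed by [f] and read from another base point. *)
Definition renamed (f : nat -> nat) (w w' : word) : Prop :=
  {in labels w &, injective f} /\ exists k, w' = rot k (map (relabel f) w).

(** * Planarity

    A Gauss word determines a 4-regular ribbon graph with one vertex per
    label and one edge from each position of the word to the next.  The dart
    [(i, true)] leaves position [i] forwards and [(i, false)] leaves it
    backwards.  [face_map] follows the boundary of the face lying on the left
    of a dart: reaching position [q], one turns left onto the other branch;
    since a head branch points to the left of its tail branch, this goes
    forwards exactly when one arrives forwards on a tail or backwards on a
    head. *)

Definition face_map (w : word) (x : 'I_(size w) * bool) : 'I_(size w) * bool :=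
  let q := if x.2 then ordS x.1 else ord_pred x.1 in
  let l := tnth (in_tuple w) q in
  (insubd q (index (opp l) w), x.2 == l.2).

(** Euler's formula for a connected curve: V - E + F = 2 with
    V = [(size w)./2] and E = [size w = 2 V]. *)
Definition planar (w : word) : bool :=
  fcard (@face_map w) predT == (size w)./2 + 2.

(** * Framed flat virtual knot diagrams with one double point

    A diagram is the Gauss word of all its crossings, virtual ones included;
    it is a curve in the plane, whence [planar].  [dbl] is the singular double
    point, and every label that is neither virtual nor [dbl] is a flat
    classical crossing. *)

Record diagram := Diagram {
  dword : word;
  virt : nat -> bool;
  dbl : nat;
  dword_gauss : gauss dword;
  dword_planar : planar dword;
  dbl_in : dbl \in labels dword;
  dbl_nvirt : ~~ virt dbl
}.

Definition flat (D : diagram) (c : nat) : bool := ~~ virt D c && (c != dbl D).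

(** ** Local moves

    The part of the curve inside a disc is the list [T] of the words read
    along its strands.  A local move replaces strand by strand [T] by [T'] and
    keeps the arcs [us] outside the disc; [q] lists the strands in the order
    in which the curve visits them. *)

Definition glue (T us : seq word) : word :=
  flatten [seq p.1 ++ p.2 | p <- zip T us].

Definition local_move (T T' : seq word) (w w' : word) : Prop :=
  exists q us, [/\ perm_eq q (zip T T'), size us = size q,
    w = glue (unzip1 q) us & w' = glue (unzip2 q) us].

(** Both values of [b] occur: the kink turns left or right. *)
Definition kink (x : nat) (b : bool) : word := [:: (x, b); (x, ~~ b)].

(** Two strands bounding a bigon with corners [x] and [y]: the strands cross
    in opposite directions at the two corners, and run in parallel
    ([par = true]) or antiparallel. *)
Definition bigon (x y : nat) (b par : bool) : seq word :=
  [:: [:: (x, b); (y, ~~ b)];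
      if par then [:: (x, ~~ b); (y, b)] else [:: (y, b); (x, ~~ b)]].

(** Three strands bounding a triangle, numbered counterclockwise, with corners
    [x] (strands 1 and 2), [y] (2 and 3) and [z] (3 and 1); [oi] tells whether
    strand [i] runs counterclockwise along the triangle.  When strands [i] and
    [i + 1] agree in this respect, strand [i + 1] leaves their corner to the
    left of strand [i], so that strand [i] is the tail branch there; otherwise
    it is the head branch. *)
Definition side (o : bool) (l l' : letter) : word :=
  if o then [:: l; l'] else [:: l'; l].

Definition triangle (o1 o2 o3 : bool) (x y z : nat) : seq word :=
  [:: side o1 (z, o3 != o1) (x, o1 == o2);
      side o2 (x, o1 != o2) (y, o2 == o3);
      side o3 (y, o2 != o3) (z, o3 == o1)].

Definition same_marks (D D' : diagram) : Prop :=
  virt D =1 virt D' /\ dbl D = dbl D'.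

(** Each move is given in one direction; [related] below adds the inverses.
    Labels occurring in only one of the two diagrams are automatically fresh in
    the other, because both are Gauss words; a planar isotopy that moves nothing
    may first give [virt] any value on a label that is not in use. *)
Inductive move (D D' : diagram) : Prop :=
  | PlanarIsotopy (f : nat -> nat) of
      renamed f (dword D) (dword D') &
      {in labels (dword D), forall c, virt D' (f c) = virt D c} &
      dbl D' = f (dbl D)
  | VirtualR1 (x : nat) (b : bool) of
      same_marks D D' & virt D x &
      local_move [:: kink x b] [:: [::]] (dword D) (dword D')
  | FramedFlatR1 (x y : nat) (b c : bool) of
      same_marks D D' & flat D x & flat D y &
      local_move [:: kink x b ++ kink y c] [:: [::]] (dword D) (dword D')
  | VirtualR2 (x y : nat) (b par : bool) of
      same_marks D D' & virt D x & virt D y &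
      local_move (bigon x y b par) [:: [::]; [::]] (dword D) (dword D')
  | FlatR2 (x y : nat) (b par : bool) of
      same_marks D D' & flat D x & flat D y &
      local_move (bigon x y b par) [:: [::]; [::]] (dword D) (dword D')
  (** Strand 3 slides across the crossing [x] of strands 1 and 2.  When it has
      virtual crossings, [x] is arbitrary (virtual Reidemeister 3, the mixed
      move, or a slide across the double point); when it has flat crossings,
      [x] is flat (flat Reidemeister 3) or the double point. *)
  | VirtualSlide (x y z : nat) (o1 o2 o3 : bool) of
      same_marks D D' & virt D y & virt D z &
      local_move (triangle o1 o2 o3 x y z)
        (triangle (~~ o1) (~~ o2) (~~ o3) x y z) (dword D) (dword D')
  | FlatSlide (x y z : nat) (o1 o2 o3 : bool) of
      same_marks D D' & ~~ virt D x & flat D y & flat D z &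
      local_move (triangle o1 o2 o3 x y z)
        (triangle (~~ o1) (~~ o2) (~~ o3) x y z) (dword D) (dword D')
  (** The move (s-ii): the underlying curve is unchanged, and the double point
      trades places with the flat crossing at the other corner of a bigon. *)
  | DoublePointFlip (y : nat) (b par : bool) of
      virt D =1 virt D' & flat D y & dbl D' = y & dword D' = dword D &
      local_move (bigon (dbl D) y b par) (bigon (dbl D) y b par)
        (dword D) (dword D').

Definition related : relation diagram := clos_refl_sym_trans diagram move.

(** * Framed singular virtual strings *)

(** [sword] is the cyclic order of the endpoints of the arrows on the core
    circle, and [pref] is the preferred arrow. *)
Record svstring := SVString {
  sword : word;
  pref : nat;
  sword_gauss : gauss sword;
  pref_in : pref \in labels sword
}.

Definition svstring_iso (a a' : svstring) : Prop :=
  exists2 f, renamed f (sword a) (sword a') & pref a' = f (pref a).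

Definition real_word (D : diagram) : word :=
  [seq l <- dword D | ~~ virt D l.1].

Fact real_word_gauss D : gauss (real_word D).
Proof.
case/andP: (dword_gauss D) => uw /allP cw; rewrite /gauss filter_uniq //=.
by apply/allP => l; rewrite !mem_filter => /andP[-> /cw].
Qed.

Fact real_word_dbl D : dbl D \in labels (real_word D).
Proof.
case/mapP: (dbl_in D) => l; rewrite mem_filter => /andP[lt lw] dl.
apply/mapP; exists l => //; rewrite !mem_filter lt lw andbT -dl.
exact: dbl_nvirt.
Qed.

Definition string_of (D : diagram) : svstring :=
  SVString (real_word_gauss D) (real_word_dbl D).

Definition homotopic (a a' : svstring) : Prop :=
  exists D D', [/\ svstring_iso (string_of D) a,
    svstring_iso (string_of D') a' & related D D'].

(** * Singular based matrices *)

Record sbm := SBM {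
  scar :> finType;
  ss : scar;
  sd : scar;
  sb : scar -> scar -> int;
  sbm_neq : ss != sd;
  sbm_skew : forall g h, sb g h = (- sb h g)%R
}.

(** ** The singular based matrix of a string *)

(** [p] is in the interior of the oriented arc from [x] to [y]. *)
Definition on_arc (w : word) (x y p : letter) : bool :=
  let i := index x w in let j := index y w in let k := index p w in
  [|| i < k < j, k < j < i | j < i < k].

(** The number of arrows with tail in the interior of the arc [xy] and head in
    the interior of the arc [zt]. *)
Definition arrows_between (w : word) (x y z t : letter) : nat :=
  count (fun c => on_arc w x y (c, true) && on_arc w z t (c, false)) (labels w).

Definition arc_dot (w : word) (x y z t : letter) : int :=
  ((arrows_between w x y z t)%:Z - (arrows_between w z t x y)%:Z)%R.

Definition link_sign (w : word) (e f : nat) : int :=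
  let x := (e, true) in let y := (e, false) in
  let z := (f, true) in let t := (f, false) in
  if on_arc w x y z && on_arc w y x t then 1%R
  else if on_arc w y x z && on_arc w x y t then (-1)%R
  else 0%R.

(** [b(e, s)] and [b(e, f)]. *)
Definition arrow_s (w : word) (e : nat) : int :=
  arc_dot w (e, true) (e, false) (e, false) (e, true).

Definition arrow_arrow (w : word) (e f : nat) : int :=
  (arc_dot w (e, true) (e, false) (f, true) (f, false) + link_sign w e f)%R.

Definition string_b (w : word) (g h : option (seq_sub (labels w))) : int :=
  match g, h with
  | Some e, Some f => arrow_arrow w (ssval e) (ssval f)
  | Some e, None => arrow_s w (ssval e)
  | None, Some f => (- arrow_s w (ssval f))%R
  | None, None => 0%R
  end.

Fact arc_dot_skew w x y z t : arc_dot w x y z t = (- arc_dot w z t x y)%R.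
Proof. by rewrite /arc_dot opprB. Qed.

Fact link_sign_skew w e f : link_sign w e f = (- link_sign w f e)%R.
Proof.
rewrite /link_sign /on_arc.
by case: ifP => H1; case: ifP => H2 //; try case: ifP => H3 //;
  try case: ifP => H4 //; lia.
Qed.

Fact string_b_skew w g h : string_b g h = (- @string_b w h g)%R.
Proof.
case: g h => [e|] [f|] /=; rewrite ?oppr0 ?opprK //.
by rewrite /arrow_arrow [RHS]opprD -arc_dot_skew -link_sign_skew.
Qed.

(** The underlying set is [option (arrows)], with [None] in the role of [s]. *)
Definition sbm_of (a : svstring) : sbm :=
  @SBM (option (seq_sub (labels (sword a)))) None (Some (SeqSub (pref_in a)))
    (@string_b (sword a)) isT (@string_b_skew (sword a)).

(** ** Homology *)

Definition is_free (M : sbm) (g : M) : bool := (g != ss M) && (g != sd M).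

Definition annihilating (M : sbm) (g : M) : Prop :=
  is_free g /\ forall h, sb g h = 0%R.

Definition core (M : sbm) (g : M) : Prop :=
  is_free g /\ forall h, sb g h = sb (ss M) h.

Definition complementary (M : sbm) (g1 g2 : M) : Prop :=
  [/\ is_free g1, is_free g2 & forall h, (sb g1 h + sb g2 h = sb (ss M) h)%R].

Definition sbm_iso (M N : sbm) : Prop :=
  exists f : M -> N, [/\ bijective f, f (ss M) = ss N, f (sd M) = sd N &
    forall g h, sb (f g) (f h) = sb g h].

(** Up to isomorphism, [N] is [M] with the two new elements [x] and [y]. *)
Definition adds_two (M N : sbm) (x y : N) : Prop :=
  x != y /\ exists f : M -> N,
    [/\ injective f, f (ss M) = ss N, f (sd M) = sd N,
        forall z, (z \in codom f) = (z != x) && (z != y) &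
        forall g h, sb (f g) (f h) = sb g h].

Definition move_M1 (M N : sbm) : Prop :=
  exists x y : N, [/\ adds_two M x y, annihilating x & annihilating y].

Definition move_M2 (M N : sbm) : Prop :=
  exists x y : N, [/\ adds_two M x y, core x & core y].

Definition move_M3 (M N : sbm) : Prop :=
  exists x y : N, adds_two M x y /\ complementary x y.

Definition move_Mw (M N : sbm) : Prop :=
  exists (f : M -> N) (g : M),
    [/\ bijective f, f (ss M) = ss N /\ f (sd M) = sd N,
        annihilating g, core (f g) &
        forall h k, h != g -> k != g -> sb (f h) (f k) = sb h k].

Definition singularity_switch (M N : sbm) : Prop :=
  exists (f : M -> N) (g : M),
    [/\ bijective f, f (ss M) = ss N /\ f g = sd N, is_free g,
        forall h, (sb g h + sb (sd M) h = sb (ss M) h)%R &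
        forall h k, sb (f h) (f k) = sb h k].

Inductive sbm_move (M N : sbm) : Prop :=
  | MoveIso of sbm_iso M N
  | MoveM1 of move_M1 M N
  | MoveM2 of move_M2 M N
  | MoveM3 of move_M3 M N
  | MoveMw of move_Mw M N
  | MoveN of singularity_switch M N.

Definition homologous : relation sbm := clos_refl_sym_trans sbm sbm_move.

(* Main.v *)
From HB Require Import structures.
From Stdlib Require Import Relations.
From mathcomp Require Import all_boot all_order all_algebra.
From mathcomp Require Import zify ring.
Require Import Defs.

(** Attach to an arrow [e] the function [A_e] on the endpoints of arrows that is 2
    inside the arc from the tail to the head of [e], 0 inside the other arc and 1
    at the two endpoints of [e], and to [s] the constant function 2.  The values
    1 absorb the sign [epsilon] of the definition of [b], and

      [4 b(g, h) = sum_c (A_g(tail c) A_h(head c) - A_g(head c) A_h(tail c))]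

    holds uniformly for all [g] and [h], the right-hand side being bilinear in
    [(A_g, A_h)].  Between consecutive endpoints, [A_e] jumps only next to the
    endpoints of [e].  Hence a kink has [A_x] or [2 - A_x] supported on its two
    adjacent endpoints, so that it is annihilating or core; the two corners of
    a bigon satisfy [A_x + A_y = 2] away from the bigon, and the contributions of
    the four remaining endpoints cancel, so that they are complementary; and a
    Reidemeister 3 move swaps three adjacent pairs of endpoints, the resulting
    changes of the sum cancelling because of the orientations around the
    triangle.  Virtual crossings are invisible in the string. *)

Set Implicit Arguments.
Unset Strict Implicit.
Unset Printing Implicit Defensive.

Import GRing.Theory.
Local Open Scope ring_scope.

(** * Arc functions on a word and their jumps *)

Definition bsign (b : bool) : int := if b then 1 else -1.

(** Twice the Heaviside function in [k] with jump at [i], taking the middle value 1 at [k = i]. *)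
Definition step (i k : nat) : int := (i < k)%N%:Z + (i <= k)%N%:Z.

(* The argument [None] stands for [s]. *)
Definition arc_value (w : word) (e : option nat) (p : letter) : int :=
  if e is Some c then
    2 * (on_arc w (c, true) (c, false) p)%:Z + (p.1 == c)%:Z
  else 2.

Arguments arc_value : simpl never.

Definition pair_term (A B : letter -> int) (c : nat) : int :=
  A (c, true) * B (c, false) - A (c, false) * B (c, true).

Definition pairing (w : word) (A B : letter -> int) : int :=
  \sum_(c <- labels w) pair_term A B c.

Definition has_label (w : word) (e : option nat) : bool :=
  if e is Some c then c \in labels w else true.

Definition swap_pos (n i : nat) : nat :=
  if i == n then n.+1 else if i == n.+1 then n else i.

Lemma step_swap_pos (n i k : nat) :
  step (swap_pos n i) (swap_pos n k) = step i k
    + 2 * (((i == n.+1) && (k == n))%:Z - ((i == n) && (k == n.+1))%:Z).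
Proof.
rewrite /step /swap_pos.
by case: (eqVneq i n) => [->|?]; case: (eqVneq k n) => [->|?];
  try case: (eqVneq i n.+1) => [->|?]; try case: (eqVneq k n.+1) => [->|?]; lia.
Qed.

Lemma index_eq (T : eqType) (s : seq T) (a b : T) :
  a \in s -> (index a s == index b s) = (a == b).
Proof.
move=> ain; apply/eqP/eqP => [eab|-> //].
by rewrite -(nth_index a ain) eab nth_index // -index_mem -eab index_mem.
Qed.

Lemma mem_labels (w : word) (c : nat) (b : bool) :
  gauss w -> c \in labels w -> (c, b) \in w.
Proof.
case/andP=> _ /allP ow /mapP[[d []]]; rewrite mem_filter //= => dw ->.
by case: b => //; apply: (ow _ dw).
Qed.

Lemma labels_mem (w : word) (l : letter) : gauss w -> l \in w -> l.1 \in labels w.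
Proof.
case/andP=> _ /allP ow; case: l => c [] lw; apply/mapP;
  by exists (c, true); rewrite ?mem_filter //=; apply: (ow _ lw).
Qed.

Lemma labels_uniq (w : word) : gauss w -> uniq (labels w).
Proof.
case/andP=> uw _; rewrite map_inj_in_uniq ?filter_uniq //.
by move=> [c b] [d b']; rewrite !mem_filter /= => /andP[-> _] /andP[-> _] ->.
Qed.

(** Turns a cyclic condition into a sum of step functions: [step t k - step h k] has the right jumps
    at both endpoints, and the constant [step h t] is 2 exactly when the arc runs past the base
    point. *)
Lemma arc_valueE (w : word) (c : nat) (p : letter) :
  gauss w -> c \in labels w -> p \in w ->
  let t := index (c, true) w in let h := index (c, false) w in
  let k := index p w in
  arc_value w (Some c) p = step h t + step t k - step h k.
Proof.
move=> gw cw pw t h k; rewrite /arc_value /on_arc -/t -/h -/k.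
have tw : (c, true) \in w by exact: mem_labels.
have hw : (c, false) \in w by exact: mem_labels.
have et := index_eq p tw; have eh := index_eq p hw.
have := index_eq (c, false) tw; rewrite -/t -/h.
rewrite /step.
have -> : (p.1 == c) = (t == k) || (h == k).
  by rewrite et eh; case: (p) => d [] /=; rewrite !xpair_eqE !andbT ?andbF ?orbF // eq_sym.
have -> : ((c, true) == (c, false) :> letter) = false by rewrite xpair_eqE andbF.
lia.
Qed.

Lemma arc_value_diag (w : word) (c : nat) (b : bool) :
  arc_value w (Some c) (c, b) = 1.
Proof.
rewrite /arc_value /on_arc /= eqxx; case: b; rewrite ?ltnn ?andbF /=; lia.
Qed.

Lemma index_at (w u v : word) (a : letter) :
  uniq w -> w = u ++ a :: v -> index a w = size u.
Proof.
move=> uw e; rewrite e index_cat; move: uw; rewrite e cat_uniq /=.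
by case/and3P => _; rewrite negb_or => /andP[/negPf -> _] _; rewrite eqxx addn0.
Qed.

Lemma bsign_index (w : word) (c : nat) (l : letter) :
  gauss w -> c \in labels w ->
  bsign l.2 * (Some c == Some l.1)%:Z =
    (index (c, true) w == index l w)%:Z - (index (c, false) w == index l w)%:Z :> int.
Proof.
move=> gw cw; rewrite !index_eq ?mem_labels // /bsign (inj_eq Some_inj).
by case: l => d [] /=; rewrite !xpair_eqE ?andbT ?andbF ?subr0 ?mul1r ?mulN1r ?sub0r.
Qed.

(** The value rises by 2 across the tail of [e] and falls by 2 across its head, half of the jump on
    each side of the endpoint. The two correction terms are the half-jumps after [a] and before
    [b]. *)
Lemma arc_value_adj (w u v : word) (a b : letter) (e : option nat) :
  gauss w -> w = u ++ a :: b :: v -> has_label w e ->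
  arc_value w e b = arc_value w e a
    + bsign a.2 * (e == Some a.1)%:Z + bsign b.2 * (e == Some b.1)%:Z.
Proof.
move=> gw ew; case: e => [c /= cw|_]; last by rewrite !mulr0 !addr0.
have [uw _] := andP gw.
have aw : a \in w by rewrite ew mem_cat inE eqxx orbT.
have bw : b \in w by rewrite ew mem_cat !inE eqxx !orbT.
have ia : index a w = size u by apply: index_at ew.
have ib : index b w = (size u).+1.
  by rewrite (@index_at w (rcons u a) v) ?size_rcons // -cats1 -catA.
rewrite (arc_valueE gw cw aw) (arc_valueE gw cw bw) !(bsign_index _ gw cw) ia ib /step.
lia.
Qed.

(* The change of [arc_value] when the adjacent letters of [S] are exchanged. *)
Definition swap_diff (S : word) (e : option nat) (p : letter) : int :=
  if S is [:: a; b] then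
    2 * (bsign b.2 * ((e == Some b.1) && (p == a))%:Z
         - bsign a.2 * ((e == Some a.1) && (p == b))%:Z)
  else 0.

Lemma gauss_perm (w w' : word) : perm_eq w w' -> gauss w = gauss w'.
Proof.
move=> pw; rewrite /gauss (perm_uniq pw) (perm_all _ pw); congr (_ && _).
by apply: eq_all => l; rewrite (perm_mem pw).
Qed.

Lemma labels_perm (w w' : word) : perm_eq w w' -> perm_eq (labels w) (labels w').
Proof. by move=> pw; apply: perm_map; apply: perm_filter. Qed.

Lemma has_label_perm (w w' : word) e : perm_eq w w' -> has_label w e = has_label w' e.
Proof. by move=> pw; case: e => //= c; rewrite (perm_mem (labels_perm pw)). Qed.

(** The exchange acts on positions as [swap_pos], so in the formula of [arc_valueE] only comparisons
    between the two exchanged positions can change. *)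
Lemma arc_value_swap (w w' u v : word) (a b : letter) (e : option nat) (p : letter) :
  gauss w -> a.1 != b.1 -> w = u ++ a :: b :: v -> w' = u ++ b :: a :: v ->
  has_label w e -> p \in w ->
  arc_value w' e p = arc_value w e p + swap_diff [:: a; b] e p.
Proof.
move=> gw nab ew ew'; case: e => [c|_ _]; last by rewrite /= /arc_value !mulr0.
move=> /= cw pw.
have pww : perm_eq w w' by rewrite ew ew' perm_cat2l -(cat1s a) -(cat1s b) perm_catCA.
have gw' : gauss w' by rewrite -(gauss_perm pww).
have [uw _] := andP gw; have [uw' _] := andP gw'.
have aw : a \in w by rewrite ew mem_cat inE eqxx orbT.
have bw : b \in w by rewrite ew mem_cat !inE eqxx !orbT.
have ia : index a w = size u by apply: index_at ew.
have ib : index b w = (size u).+1.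
  by rewrite (@index_at w (rcons u a) v) ?size_rcons // -cats1 -catA.
have ib' : index b w' = size u by apply: index_at ew'.
have ia' : index a w' = (size u).+1.
  by rewrite (@index_at w' (rcons u b) v) ?size_rcons // -cats1 -catA.
have io l : l != a -> l != b -> index l w' = index l w.
  move=> la lb; rewrite ew ew' !index_cat /= ![_ == l]eq_sym (negPf la) (negPf lb).
  by case: ifP.
have idx (l : letter) : l \in w -> index l w' = swap_pos (size u) (index l w).
  move=> lw; rewrite /swap_pos -{1}ia -ib !index_eq //.
  case: eqP => [->|/eqP la]; first by rewrite ia'.
  by case: eqP => [->|/eqP lb]; [rewrite ib' | rewrite io].
have tw : (c, true) \in w by exact: mem_labels.
have hw : (c, false) \in w by exact: mem_labels.
rewrite (arc_valueE gw cw pw).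
rewrite (@arc_valueE w' c p) -?(perm_mem pww) -?(perm_mem (labels_perm pww)) //=.
have sb (l : letter) (P : bool) : bsign l.2 * ((Some c == Some l.1) && P)%:Z =
    ((index (c, true) w == index l w) && P)%:Z - ((index (c, false) w == index l w) && P)%:Z.
  by case: P; rewrite ?andbT ?andbF ?mulr0 // (bsign_index l gw cw).
rewrite !sb -!(index_eq _ pw) !idx // ia ib.
(* As [a] and [b] have different labels, they are not the two endpoints of [c]; hence the constant
   [step h t] is unchanged. *)
have tha : ~~ ((index (c, true) w == size u) && (index (c, false) w == (size u).+1)).
  rewrite -ib -ia !index_eq //; apply: contra nab => /andP[/eqP <- /eqP <-] //.
have thb : ~~ ((index (c, false) w == size u) && (index (c, true) w == (size u).+1)).
  rewrite -ib -ia !index_eq //; apply: contra nab => /andP[/eqP <- /eqP <-] //.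
rewrite !step_swap_pos (negPf thb) [(_ == _) && (index (c, true) w == _)]andbC (negPf tha).
ring.
Qed.

Lemma step_sym (i k : nat) : step i k = 2 - step k i.
Proof. by rewrite /step; lia. Qed.

(** * Gluing strands to outside arcs *)

Lemma glue_cons (S : word) (T : seq word) (u : word) (us : seq word) :
  glue (S :: T) (u :: us) = S ++ u ++ glue T us.
Proof. by rewrite /glue /= catA. Qed.

Lemma perm_glue (T us : seq word) :
  size T = size us -> perm_eq (glue T us) (flatten T ++ flatten us).
Proof.
elim: T us => [|S T IH] [|u us] //= [/IH pT].
by rewrite glue_cons -catA perm_cat2l perm_sym perm_catCA perm_cat2l perm_sym.
Qed.

Lemma filter_glue (P : pred letter) (T us : seq word) :
  filter P (glue T us) = glue (map (filter P) T) (map (filter P) us).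
Proof.
elim: T us => [|S T IH] [|u us] //=.
by rewrite !glue_cons !filter_cat IH.
Qed.

Lemma glue_infix (T us : seq word) (S : word) :
  size T = size us -> S \in T -> exists u v, glue T us = u ++ S ++ v.
Proof.
elim: T us => [|S' T IH] [|u us] //= [sT]; rewrite inE => /orP[/eqP->|ST].
  by exists [::], (u ++ glue T us); rewrite glue_cons.
have [v [v' ev]] := IH us sT ST.
by exists (S' ++ u ++ v), v'; rewrite glue_cons ev !catA.
Qed.

(** The strands are exchanged one at a time. Since [swap_diff] depends on the strand and not on the
    rest of the word, the changes add up; [pre] collects the part already treated. *)
Lemma arc_value_glue (q : seq (word * word)) (us : seq word) (pre : word)
    (e : option nat) (p : letter) :
  size q = size us ->
  {in q, forall s, exists a b, [/\ a.1 != b.1, s.1 = [:: a; b] & s.2 = [:: b; a]]} ->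
  let w := pre ++ glue (unzip1 q) us in
  gauss w -> has_label w e -> p \in w ->
  arc_value (pre ++ glue (unzip2 q) us) e p
    = arc_value w e p + \sum_(s <- q) swap_diff s.1 e p.
Proof.
elim: q us pre => [|[S S'] q IH] [|u us] pre //=; first by rewrite big_nil addr0.
case=> sq sw; rewrite !glue_cons big_cons.
have [a [b [nab /= -> ->]]] := sw (S, S') (mem_head _ _).
set w := pre ++ _; set w1 := pre ++ [:: b; a] ++ u ++ glue (unzip1 q) us.
have pw : perm_eq w w1.
  by rewrite perm_cat2l -(cat1s a [:: b]) -(cat1s b [:: a]) -!catA perm_catCA.
move=> gw ew pin.
rewrite addrA -(@arc_value_swap w w1 pre (u ++ glue (unzip1 q) us) a b) //.
have := IH us (pre ++ [:: b; a] ++ u) sq; rewrite -!catA -/w1; apply.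
- by move=> s sin; apply: sw; rewrite inE sin orbT.
- by rewrite -(gauss_perm pw).
- by rewrite -(has_label_perm _ pw).
- by rewrite -(perm_mem pw).
Qed.

(** * Matrix entries as pairings of arc functions *)

Lemma natz_count (T : Type) (P : pred T) (s : seq T) :
  (count P s)%:Z = \sum_(c <- s) (P c)%:Z :> int.
Proof. by elim: s => [|c s IH]; rewrite ?big_nil //= big_cons -IH PoszD. Qed.

Lemma sum_delta (s : seq nat) (e : nat) (F : nat -> int) :
  uniq s -> e \in s -> \sum_(c <- s) (c == e)%:Z * F c = F e.
Proof.
move=> us es; rewrite (bigD1_seq e) //= eqxx mul1r big1 ?addr0 // => c /negPf ->.
by rewrite mul0r.
Qed.

Lemma arc_dot_sum (w : word) (x y z t : letter) :
  arc_dot w x y z t = \sum_(c <- labels w)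
    ((on_arc w x y (c, true))%:Z * (on_arc w z t (c, false))%:Z
     - (on_arc w x y (c, false))%:Z * (on_arc w z t (c, true))%:Z).
Proof.
rewrite /arc_dot /arrows_between !natz_count -sumrB; apply: eq_bigr => c _.
by do 4 case: on_arc.
Qed.

Lemma pairing_skew (w : word) (A B : letter -> int) :
  pairing w A B = - pairing w B A.
Proof. by rewrite /pairing -sumrN; apply: eq_bigr => c _; rewrite /pair_term; ring. Qed.

Lemma on_arc_compl (w : word) (c : nat) (p : letter) :
  gauss w -> c \in labels w -> p \in w -> p.1 != c ->
  on_arc w (c, false) (c, true) p = ~~ on_arc w (c, true) (c, false) p.
Proof.
move=> gw cw pw pc; rewrite /on_arc.
have := index_eq (c, true) pw; have := index_eq (c, false) pw.
have := index_eq (c, false) (mem_labels true gw cw).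
case: p pw pc => d b /= pw /negPf dc; rewrite !xpair_eqE dc /= andbF; lia.
Qed.

Lemma on_arc_self (w : word) (c : nat) (b b' : bool) :
  on_arc w (c, b') (c, ~~ b') (c, b) = false.
Proof. by rewrite /on_arc; case: b; case: b'; rewrite !ltnn ?andbF ?orbF /=; lia. Qed.

Lemma arrow_s_pairing (w : word) (e : nat) :
  gauss w -> e \in labels w ->
  4 * arrow_s w e = pairing w (arc_value w (Some e)) (arc_value w None).
Proof.
move=> gw ew; rewrite /arrow_s arc_dot_sum mulr_sumr /pairing.
apply: eq_big_seq => c cw; rewrite /pair_term /arc_value /=.
case: (eqVneq c e) => [->|ce].
  by rewrite (on_arc_self w e _ true) (on_arc_self w e _ true).
rewrite !(@on_arc_compl w e) ?mem_labels //.
by do 2 case: on_arc.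
Qed.

(** For distinct arrows each of the two differences equals the sign: the linking of two chords can
    be read off either of them. For [e = f] all terms vanish, as endpoints are not interior to their
    own arc. *)
Lemma link_sign_arc (w : word) (e f : nat) :
  gauss w -> e \in labels w -> f \in labels w ->
  2 * link_sign w e f =
    (on_arc w (f, true) (f, false) (e, false))%:Z
    - (on_arc w (f, true) (f, false) (e, true))%:Z
    + (on_arc w (e, true) (e, false) (f, true))%:Z
    - (on_arc w (e, true) (e, false) (f, false))%:Z.
Proof.
move=> gw ew fw; rewrite /link_sign.
case: (eqVneq e f) => [<-|ef].
  by rewrite !(on_arc_self w e _ true) !(on_arc_self w e _ false).
have fe : f != e by rewrite eq_sym.
(* Both sides consist of the same four comparisons of positions, with arguments exchanged. *)
have E : arc_value w (Some f) (e, false) - arc_value w (Some f) (e, true)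
       = arc_value w (Some e) (f, true) - arc_value w (Some e) (f, false).
  rewrite !(arc_valueE gw) ?mem_labels //.
  rewrite ![step (index (f, _) w) (index (e, _) w)]step_sym; ring.
rewrite !(@on_arc_compl w e) ?mem_labels //.
move: E; rewrite /arc_value /= (negPf ef) (negPf fe).
by do 4 case: on_arc.
Qed.

Lemma arrow_arrow_pairing (w : word) (e f : nat) :
  gauss w -> e \in labels w -> f \in labels w ->
  4 * arrow_arrow w e f = pairing w (arc_value w (Some e)) (arc_value w (Some f)).
Proof.
move=> gw ew fw; rewrite /arrow_arrow mulrDr arc_dot_sum.
have uw := labels_uniq gw.
(* Expand both arc functions as twice an indicator plus a delta. The mixed sums add up to four times
   the sign by [link_sign_arc]; the product of the two deltas is the same at tail and head and drops
   out. *)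
transitivity (4 * \sum_(c <- labels w)
    ((on_arc w (e, true) (e, false) (c, true))%:Z * (on_arc w (f, true) (f, false) (c, false))%:Z
     - (on_arc w (e, true) (e, false) (c, false))%:Z * (on_arc w (f, true) (f, false) (c, true))%:Z)
  + 2 * \sum_(c <- labels w) (c == e)%:Z * ((on_arc w (f, true) (f, false) (c, false))%:Z
    - (on_arc w (f, true) (f, false) (c, true))%:Z)
  + 2 * \sum_(c <- labels w) (c == f)%:Z * ((on_arc w (e, true) (e, false) (c, true))%:Z
    - (on_arc w (e, true) (e, false) (c, false))%:Z)).
  rewrite !sum_delta // -addrA; congr (_ + _).
  by have := link_sign_arc gw ew fw; lia.
rewrite !mulr_sumr -!big_split /=; apply: eq_bigr => c _.
rewrite /pair_term /arc_value /=; ring.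
Qed.

(** Elements of matrices of different strings have different types; they are compared through their
    labels. *)
Definition label (a : svstring) (g : sbm_of a) : option nat :=
  omap (@ssval _ _) (g : option (seq_sub (labels (sword a)))).

Lemma has_labelP (a : svstring) (g : sbm_of a) : has_label (sword a) (label g).
Proof. by case: g => // c; apply: ssvalP. Qed.

(** As 4 can be cancelled in [int], identities between matrix entries may be proved for [pairing],
    with [s] treated like an arrow. *)
Lemma sb_pairing (a : svstring) (g h : sbm_of a) :
  4 * sb g h = pairing (sword a) (arc_value (sword a) (label g))
                                 (arc_value (sword a) (label h)).
Proof.
have gw := sword_gauss a.
case: g h => [e|] [f|] /=.
- by rewrite arrow_arrow_pairing ?ssvalP.
- by rewrite arrow_s_pairing ?ssvalP.
- by rewrite mulrN arrow_s_pairing ?ssvalP // -pairing_skew.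
- by rewrite mulr0 /pairing big1.
Qed.

Lemma label_inj (a : svstring) : injective (@label a).
Proof. by case=> [e|] [f|] //= [] /val_inj ->. Qed.

Lemma label_ex (a : svstring) (e : option nat) :
  has_label (sword a) e -> exists g : sbm_of a, label g = e.
Proof.
case: e => [c cw|_]; last by exists None.
by exists (Some (SeqSub cw)).
Qed.

(** * Erasing arrows *)

Lemma index_filter_lt (w : word) (P : pred letter) (a b : letter) :
  P a -> P b ->
  (index a (filter P w) < index b (filter P w))%N = (index a w < index b w)%N.
Proof.
move=> Pa Pb; elim: w => //= l w IH.
case: (boolP (P l)) => Pl /=; first by do 2 case: ifP => //.
have -> : (l == a) = false by apply: contraNF Pl => /eqP ->.
by have -> : (l == b) = false by apply: contraNF Pl => /eqP ->.
Qed.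

Lemma on_arc_filter (w : word) (P : pred letter) (x y p : letter) :
  P x -> P y -> P p -> on_arc (filter P w) x y p = on_arc w x y p.
Proof. by move=> Px Py Pp; rewrite /on_arc !index_filter_lt. Qed.

Definition erase (s : seq nat) (w : word) : word := [seq l <- w | l.1 \notin s].

Lemma erase_gauss (s : seq nat) (w : word) : gauss w -> gauss (erase s w).
Proof.
case/andP => uw /allP ow; rewrite /gauss filter_uniq //=.
by apply/allP => l; rewrite !mem_filter => /andP[-> /ow].
Qed.

Lemma mem_labels_erase (s : seq nat) (w : word) (c : nat) :
  (c \in labels (erase s w)) = (c \notin s) && (c \in labels w).
Proof.
apply/mapP/andP => [[l]|[cs /mapP[l]]].
  by rewrite !mem_filter => /and3P[lt ls lw] ->; split=> //; apply/mapP; exists l;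
    rewrite ?mem_filter ?lt.
by rewrite mem_filter => /andP[lt lw] el; exists l; rewrite // !mem_filter lt lw -el cs.
Qed.

Lemma arc_value_erase (s : seq nat) (w : word) (e : option nat) (p : letter) :
  has_label (erase s w) e -> p.1 \notin s ->
  arc_value (erase s w) e p = arc_value w e p.
Proof.
case: e => [c|] //=; rewrite mem_labels_erase => /andP[cs _] ps.
by rewrite /arc_value on_arc_filter.
Qed.

Lemma pairing_erase (s : seq nat) (w : word) (A B : letter -> int) :
  gauss w -> uniq s -> {subset s <= labels w} ->
  pairing w A B = \sum_(c <- s) pair_term A B c + pairing (erase s w) A B.
Proof.
move=> gw us sw; have gw' := erase_gauss s gw; rewrite /pairing -big_cat /=; apply: perm_big.
apply: uniq_perm; first exact: labels_uniq.
  rewrite cat_uniq us labels_uniq // andbT /=.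
  by apply/hasPn => c; rewrite mem_labels_erase => /andP[].
move=> c; rewrite mem_cat mem_labels_erase.
by case: (boolP (c \in s)) => [/sw ->|].
Qed.

Lemma pairing_erase2 (w : word) (x y : nat) (A B : letter -> int) :
  gauss w -> x != y -> x \in labels w -> y \in labels w ->
  pairing w A B = pair_term A B x + pair_term A B y + pairing (erase [:: x; y] w) A B.
Proof.
move=> gw xy xw yw; rewrite (@pairing_erase [:: x; y]) //= ?inE ?xy //.
  by rewrite !big_cons big_nil addr0.
by move=> c; rewrite !inE => /orP[] /eqP ->.
Qed.

Lemma pair_termE (A B : letter -> int) (c : nat) (b : bool) :
  pair_term A B c = bsign b * (A (c, b) * B (c, ~~ b) - A (c, ~~ b) * B (c, b)).
Proof. by rewrite /pair_term /bsign; case: b => /=; ring. Qed.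

(** Erasing letters keeps the values of the other arc functions at the other endpoints. An old entry
    can thus change only through the summands indexed by [x] and [y], which are assumed to
    cancel. *)
Lemma adds_two_erase (a a' : svstring) (X Y : sbm_of a) (x y : nat) :
  x != y -> label X = Some x -> label Y = Some y -> pref a' = pref a ->
  sword a' = erase [:: x; y] (sword a) ->
  (forall e f, has_label (sword a') e -> has_label (sword a') f ->
     pair_term (arc_value (sword a) e) (arc_value (sword a) f) x
     + pair_term (arc_value (sword a) e) (arc_value (sword a) f) y = 0) ->
  adds_two (sbm_of a') X Y.
Proof.
move=> xy eX eY epref ew' cancel; split.
  by apply: contra xy => /eqP eXY; rewrite -(inj_eq Some_inj) -eX eXY eY.
have gw := sword_gauss a; have gw' := sword_gauss a'.
have sub c : c \in labels (sword a') -> c \in labels (sword a).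
  by rewrite ew' mem_labels_erase => /andP[].
pose f (g : sbm_of a') : sbm_of a :=
  if g is Some c then Some (SeqSub (sub _ (ssvalP c))) else None.
have lf g : label (f g) = label g by case: g.
exists f; split=> //.
- by move=> g h e; apply: label_inj; rewrite -lf e lf.
- by apply: label_inj; rewrite lf /= epref.
- move=> z; have -> : (z \in codom f) = has_label (sword a') (label z).
    apply/codomP/idP => [[g ->]|/label_ex[g eg]]; first by rewrite lf has_labelP.
    by exists g; apply: label_inj; rewrite lf.
  rewrite -!(inj_eq (@label_inj a)) eX eY; have := has_labelP z.
  case: (label z) => //= c cw; rewrite ew' mem_labels_erase !(inj_eq Some_inj) !inE negb_or cw.
  by rewrite andbT.
move=> g h; suff : 4 * sb (f g) (f h) = 4 * sb g h by lia.
rewrite !sb_pairing !lf (@pairing_erase2 _ x y) ?cancel ?has_labelP ?add0r -?ew' //.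
- apply: eq_big_seq => c cw; rewrite /pair_term.
  have cs : c \notin [:: x; y] by move: cw; rewrite ew' mem_labels_erase => /andP[].
  have gP := has_labelP g; have hP := has_labelP h.
  by rewrite ew' in gP hP *; rewrite !arc_value_erase.
- by have := has_labelP X; rewrite eX.
- by have := has_labelP Y; rewrite eY.
Qed.

(** * Change of labels and of base point *)

Lemma sbm_iso_relabel (a a' : svstring) (f : nat -> nat) :
  {in labels (sword a) &, injective f} ->
  size (labels (sword a)) = size (labels (sword a')) ->
  (forall c, c \in labels (sword a) -> f c \in labels (sword a')) ->
  pref a' = f (pref a) ->
  (forall e e', has_label (sword a) e -> has_label (sword a) e' ->
    pairing (sword a') (arc_value (sword a') (omap f e)) (arc_value (sword a') (omap f e'))
    = pairing (sword a) (arc_value (sword a) e) (arc_value (sword a) e')) ->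
  sbm_iso (sbm_of a) (sbm_of a').
Proof.
move=> fi fs fw fp fpair.
pose F (g : sbm_of a) : sbm_of a' :=
  if g is Some c then Some (SeqSub (fw _ (ssvalP c))) else None.
have lF g : label (F g) = omap f (label g) by case: g.
exists F; split.
- apply: inj_card_bij.
    move=> g h e; apply: label_inj; move: (congr1 (@label a') e); rewrite !lF.
    have := has_labelP g; have := has_labelP h.
    by case: (label g) => [c|]; case: (label h) => [d|] //= dw cw [] /fi ->.
  rewrite !card_option !card_seq_sub ?labels_uniq ?sword_gauss // fs //.
- by [].
- by apply: label_inj; rewrite lF /= fp.
- move=> g h; suff : 4 * sb (F g) (F h) = 4 * sb g h by lia.
  by rewrite !sb_pairing !lF fpair ?has_labelP.
Qed.

Lemma on_arc_rot (w : word) (k : nat) (x y p : letter) :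
  uniq w -> x \in w -> y \in w -> p \in w -> on_arc (rot k w) x y p = on_arc w x y p.
Proof.
rewrite /rot -{1 2 3 4 7}(cat_take_drop k w).
move: (take k w) (drop k w) => u v; rewrite cat_uniq => /and3P[_ /hasPn dis _].
(* The position of a letter before and after the blocks [u] and [v] trade places; invariance of the
   cyclic order is then arithmetic. *)
have I (l : letter) : l \in u ++ v -> exists i, [/\ index l (u ++ v) = i, (i < size u + size v)%N
    & index l (v ++ u) = if (i < size u)%N then (size v + i)%N else (i - size u)%N].
  rewrite mem_cat => /orP[lu|lv].
    have lv : l \notin v by apply/negP => /dis; rewrite /= lu.
    exists (index l u); rewrite !index_cat lu (negPf lv); move: lu; rewrite -index_mem => lu.
    by split=> //; [exact: ltn_addr | rewrite lu].
  have lu := dis l lv; rewrite /= in lu.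
  exists (size u + index l v)%N; rewrite !index_cat lv (negPf lu); move: lv; rewrite -index_mem => lv.
  by split=> //; [rewrite ltn_add2l | rewrite ltnNge leq_addr addKn].
move=> /I[i [ei li ei']] /I[j [ej lj ej']] /I[h [eh lh eh']].
rewrite /on_arc ei ei' ej ej' eh eh'.
by case: ifP => ?; case: ifP => ?; case: ifP => ?; lia.
Qed.

Lemma arc_value_rot (w : word) (k : nat) (e : option nat) (p : letter) :
  gauss w -> has_label w e -> p \in w -> arc_value (rot k w) e p = arc_value w e p.
Proof.
move=> gw; case: e => //= c cw pw; rewrite /arc_value on_arc_rot ?mem_labels //.
by case/andP: gw.
Qed.

Lemma index_map_in (T U : eqType) (f : T -> U) (s : seq T) (x : T) :
  {in s &, injective f} -> x \in s -> index (f x) (map f s) = index x s.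
Proof.
elim: s => //= y s IH fi; rewrite inE.
case: (eqVneq y x) => [->|yx]; first by rewrite eqxx.
move=> /= xs.
rewrite (inj_in_eq fi) ?inE ?eqxx ?xs ?orbT // (negPf yx) IH // => a b a_s b_s.
by apply: fi; rewrite inE ?a_s ?b_s orbT.
Qed.

Lemma labels_relabel (w : word) (f : nat -> nat) :
  labels (map (relabel f) w) = map f (labels w).
Proof. by rewrite /labels filter_map -!map_comp. Qed.

Lemma arc_value_relabel (w : word) (f : nat -> nat) (e : option nat) (p : letter) :
  gauss w -> {in labels w &, injective f} -> has_label w e -> p \in w ->
  arc_value (map (relabel f) w) (omap f e) (relabel f p) = arc_value w e p.
Proof.
move=> gw fi; case: e => //= c cw pw.
have ri : {in w &, injective (relabel f)}.
  move=> [l b] [l' b'] lw lw' [efl ->].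
  by rewrite (fi l l') // ?(labels_mem gw lw) ?(labels_mem gw lw').
rewrite /arc_value /on_arc -!/(relabel f (c, _)).
rewrite !(index_map_in ri) ?mem_labels //=.
by rewrite (inj_in_eq fi) // labels_mem.
Qed.

Lemma svstring_iso_sbm (a a' : svstring) :
  svstring_iso a a' -> sbm_iso (sbm_of a) (sbm_of a').
Proof.
case=> f [fi [k ew]] ep; have gw := sword_gauss a; have gw' := sword_gauss a'.
set w := sword a in fi ew gw *.
have pw' : perm_eq (sword a') (map (relabel f) w) by rewrite ew perm_rot.
have lw' : perm_eq (labels (sword a')) (map f (labels w)).
  by rewrite -labels_relabel; apply: labels_perm.
have gm : gauss (map (relabel f) w) by rewrite -(gauss_perm pw').
apply: (@sbm_iso_relabel _ _ f) => //.
- by rewrite (perm_size lw') (size_map f).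
- by move=> c cw; rewrite (perm_mem lw') map_f.
have V e p : has_label w e -> p \in w ->
    arc_value (sword a') (omap f e) (relabel f p) = arc_value w e p.
  move=> eP pw; rewrite ew arc_value_rot ?arc_value_relabel ?map_f //.
  by case: e eP => //= c cw; rewrite labels_relabel map_f.
move=> e e' eP eP'; rewrite /pairing (perm_big _ lw') big_map.
apply: eq_big_seq => c cw; rewrite /pair_term.
by rewrite -![(f c, _)]/(relabel f (c, _)) !V ?mem_labels.
Qed.

(** * Kinks *)

Lemma homologous_iso (M N : sbm) : sbm_iso M N -> homologous M N.
Proof. by move=> iso; apply: rst_step; apply: MoveIso. Qed.

Lemma adds_two_sym (M N : sbm) (x y : N) : adds_two M x y -> adds_two M y x.
Proof.
case=> xy [f [fi fs fd fc fb]]; split; first by rewrite eq_sym.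
by exists f; split=> // z; rewrite fc andbC.
Qed.

Lemma homologous_core_annihilating (M N : sbm) (x y : N) :
  adds_two M x y -> core x -> annihilating y -> homologous M N.
Proof.
case=> xy [f [fi fs fd fc fb]] [frx cx] [fry ay].
(* The core element is first added as an annihilating one. *)
pose b (g h : N) : int := if (g == x) || (h == x) then 0 else sb g h.
have bskew g h : b g h = - b h g.
  by rewrite /b orbC; case: ifP; rewrite ?oppr0 // -sbm_skew.
pose N' := @SBM (scar N) (ss N) (sd N) b (sbm_neq N) bskew.
apply: (@rst_trans _ _ _ N').
  apply/rst_step/MoveM1; exists (x : N'), (y : N'); split.
  - split=> //; exists f; split=> // g h; rewrite /= /b.
    have nx k : (f k == x) = false.
      by have := codom_f f k; rewrite fc => /andP[/negPf].
    by rewrite !nx fb.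
  - by split=> // h; rewrite /= /b eqxx.
  - by split=> // h; rewrite /= /b ay; case: ifP.
apply/rst_step/MoveMw; exists (fun g : N' => g : N), (x : N'); split=> //.
- by exists id.
- by split=> // h; rewrite /= /b eqxx.
- by move=> h k hx kx; rewrite /= /b (negPf hx) (negPf kx).
Qed.

(** Two kinks of the same kind are covered by [move_M1] or [move_M2]; the mixed cases are where
    [move_Mw] enters. *)
Lemma homologous_adds_kinks (M N : sbm) (x y : N) :
  adds_two M x y -> annihilating x \/ core x -> annihilating y \/ core y ->
  homologous M N.
Proof.
move=> xy [ax|cx] [ay|cy].
- by apply/rst_step/MoveM1; exists x, y.
- exact: homologous_core_annihilating (adds_two_sym xy) cy ax.
- exact: homologous_core_annihilating xy cx ay.
- by apply/rst_step/MoveM2; exists x, y.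
Qed.

(** For [b = true] the arc from tail to head has empty interior; for [b = false] its interior
    contains all endpoints of the other arrows. *)
Lemma arc_value_kink (w u v : word) (x : nat) (b : bool) (p : letter) :
  gauss w -> w = u ++ [:: (x, b), (x, ~~ b) & v] -> p \in w ->
  arc_value w (Some x) p = (if b then 0 else 2) + bsign b * (p.1 == x)%:Z.
Proof.
move=> gw ew pw; have [uw _] := andP gw.
have bw : (x, b) \in w by rewrite ew mem_cat inE eqxx orbT.
have xw := labels_mem gw bw.
have ib := index_at uw ew.
have ic : index (x, ~~ b) w = (size u).+1.
  by rewrite (@index_at w (rcons u (x, b)) v) ?size_rcons // -cats1 -catA.
case: (eqVneq p.1 x) => [px|px].
  rewrite [p]surjective_pairing px arc_value_diag /=.
  by case: (b); rewrite /bsign.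
have := index_eq p bw; have := index_eq p (mem_labels (~~ b) gw xw).
rewrite (arc_valueE gw xw pw) ib ic.
have np c : ((x, c) == p) = false by apply: contraNF px => /eqP <-.
rewrite !np.
by case: b ib ic {ew bw xw} => /= -> ->; rewrite /step; lia.
Qed.

(** The constant part of the arc function of [x] gives 0 or the row of [s]. The part supported on
    the kink contributes, up to sign, the difference of the values of [e] at the tail and head of
    [x]. These are adjacent and their half-jumps cancel, even for [e = Some x]. *)
Lemma pairing_kink (w u v : word) (x : nat) (b : bool) (e : option nat) :
  gauss w -> w = u ++ [:: (x, b), (x, ~~ b) & v] -> has_label w e ->
  pairing w (arc_value w (Some x)) (arc_value w e)
  = if b then 0 else pairing w (arc_value w None) (arc_value w e).
Proof.
move=> gw ew eP; have adj := arc_value_adj gw ew eP.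
have bw : (x, b) \in w by rewrite ew mem_cat inE eqxx orbT.
have xw := labels_mem gw bw.
transitivity ((if b then 0 else pairing w (arc_value w None) (arc_value w e))
  + \sum_(c <- labels w) (c == x)%:Z * (bsign b * (arc_value w e (c, false) - arc_value w e (c, true)))).
  rewrite /pairing; case: b ew {adj bw xw} => ew; rewrite ?add0r -?big_split;
  apply: eq_big_seq => c cw; rewrite /pair_term !(arc_value_kink gw ew) ?mem_labels //=;
  rewrite /arc_value /bsign; ring.
rewrite sum_delta ?labels_uniq //.
suff -> : arc_value w e (x, false) = arc_value w e (x, true) by rewrite subrr mulr0 addr0.
by move: adj; case: b {ew bw xw} => /= ->; rewrite /bsign; ring.
Qed.

Lemma kink_element (a : svstring) (X : sbm_of a) (u v : word) (x : nat) (b : bool) :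
  sword a = u ++ [:: (x, b), (x, ~~ b) & v] -> label X = Some x -> x != pref a ->
  annihilating X \/ core X.
Proof.
move=> ew eX xp; have gw := sword_gauss a.
have fX : is_free X.
  by rewrite /is_free -!(inj_eq (@label_inj a)) eX /= (inj_eq Some_inj).
have P h := pairing_kink gw ew (has_labelP h).
case: b ew P => _ P; [left|right]; split=> // h.
  by have := sb_pairing X h; rewrite eX P; lia.
have := sb_pairing X h; rewrite eX P.
by have := sb_pairing (ss (sbm_of a)) h => /= <-; lia.
Qed.

(** * Bigons *)

Lemma step_adj (w u v : word) (a b p : letter) :
  gauss w -> w = u ++ [:: a, b & v] -> p \in w -> p != a -> p != b ->
  step (index a w) (index p w) = step (index b w) (index p w).
Proof.
move=> gw ew pw pa pb; have [uw _] := andP gw.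
have ia := index_at uw ew.
have ib : index b w = (size u).+1.
  by rewrite (@index_at w (rcons u a) v) ?size_rcons // -cats1 -catA.
have := index_eq a pw; have := index_eq b pw; rewrite ia ib (negPf pa) (negPf pb) /step.
lia.
Qed.

(** On each strand an endpoint of [x] is next to the endpoint of [y] of the opposite kind. Seen from
    [p], their steps agree and cancel in the sum, leaving only the two constants of [arc_valueE]. *)
Lemma arc_value_bigon (w u v u' v' : word) (x y : nat) (b par : bool) (p : letter) :
  gauss w -> x != y -> w = u ++ [:: (x, b), (y, ~~ b) & v] ->
  w = u' ++ nth [::] (bigon x y b par) 1 ++ v' -> p \in w -> p.1 != x -> p.1 != y ->
  arc_value w (Some x) p + arc_value w (Some y) p = 2.
Proof.
move=> gw xy ew ew' pw px py.
have nx c : (x, c) != p by apply: contraNneq px => <-.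
have ny c : (y, c) != p by apply: contraNneq py => <-.
have yx : y != x by rewrite eq_sym.
have xw : x \in labels w.
  by apply: (@labels_mem w (x, b)); rewrite // ew mem_cat inE eqxx orbT.
have yw : y \in labels w.
  by apply: (@labels_mem w (y, ~~ b)); rewrite // ew mem_cat !inE eqxx !orbT.
have S1 q : q \in w -> q != (x, b) -> q != (y, ~~ b) ->
    step (index (x, b) w) (index q w) = step (index (y, ~~ b) w) (index q w).
  exact: step_adj ew.
have S2 q : q \in w -> q != (x, ~~ b) -> q != (y, b) ->
    step (index (x, ~~ b) w) (index q w) = step (index (y, b) w) (index q w).
  move=> qw qx qy; case: par ew' => ew'; first exact: step_adj ew' _ _ _.
  by symmetry; apply: step_adj ew' _ _ _.
have np c d : (c, d) != (c, ~~ d) :> letter by rewrite xpair_eqE eqxx; case: d.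
(* Replacing both arguments by their neighbours compares the constants of [x] and [y]; with
   [step_sym] they sum to 2. *)
have X1 : step (index (x, b) w) (index (x, ~~ b) w) = step (index (y, ~~ b) w) (index (y, b) w).
  rewrite S1 ?mem_labels // 1?[step (index (y, _) w) _]step_sym.
  - by rewrite S2 ?mem_labels ?xpair_eqE ?(negPf yx) //; [rewrite [RHS]step_sym | case: (b); rewrite andbF].
  - by rewrite xpair_eqE; case: (b); rewrite andbF.
  - by rewrite xpair_eqE (negPf xy).
have Sp1 := S1 p pw; have Sp2 := S2 p pw.
rewrite !(arc_valueE gw) //.
rewrite ![p == _]eq_sym !nx !ny in Sp1 Sp2.
case: b {S1 S2 ew ew' np} X1 Sp1 Sp2 => /= X1 Sp1 Sp2; rewrite Sp1 // Sp2 //.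
  rewrite [step (index (x, false) w) _]step_sym X1; ring.
by rewrite X1 step_sym; ring.
Qed.

Lemma pairing_bigon (w u v u' v' : word) (x y : nat) (b par : bool) (e : option nat) :
  gauss w -> x != y -> w = u ++ [:: (x, b), (y, ~~ b) & v] ->
  w = u' ++ nth [::] (bigon x y b par) 1 ++ v' -> has_label w e ->
  pairing w (arc_value w (Some x)) (arc_value w e)
  + pairing w (arc_value w (Some y)) (arc_value w e)
  = pairing w (arc_value w None) (arc_value w e).
Proof.
move=> gw xy ew ew' eP.
have xw : x \in labels w.
  by apply: (@labels_mem w (x, b)); rewrite // ew mem_cat inE eqxx orbT.
have yw : y \in labels w.
  by apply: (@labels_mem w (y, ~~ b)); rewrite // ew mem_cat !inE eqxx !orbT.
rewrite !(@pairing_erase2 w x y) //.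
have -> : pairing (erase [:: x; y] w) (arc_value w None) (arc_value w e)
  = pairing (erase [:: x; y] w) (arc_value w (Some x)) (arc_value w e)
    + pairing (erase [:: x; y] w) (arc_value w (Some y)) (arc_value w e).
  rewrite /pairing -big_split; apply: eq_big_seq => c.
  rewrite mem_labels_erase !inE negb_or => /andP[/andP[cx cy] cw].
  have V d := arc_value_bigon gw xy ew ew' (mem_labels d gw cw) cx cy.
  by rewrite /= /pair_term -[arc_value w None _](V true) -[arc_value w None (c, false)](V false); ring.
set P := pairing _ _ _; set P' := pairing _ _ _.
have adj1 c (cP : has_label w c) := arc_value_adj gw ew cP.
(* The second strand meets [x] first if [par] holds and [y] first otherwise; [bsign par] absorbs the
   reversal. *)
have adj2 c : has_label w c -> arc_value w c (y, b) = arc_value w c (x, ~~ b)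
   + bsign par * (bsign (~~ b) * (c == Some x)%:Z + bsign b * (c == Some y)%:Z).
  move=> cP; case: par ew' => /= ew'; rewrite ?(arc_value_adj gw ew' cP) /=.
    by rewrite /bsign; ring.
  by rewrite /bsign; ring.
have yx : y != x by rewrite eq_sym.
(* Applied to [x] and [y] themselves, adjacency gives their values at the bigon explicitly. The four
   endpoints then yield a polynomial identity in the values of [e] at the two endpoints of [x]. *)
have := adj1 _ eP; have := adj2 _ eP.
have := adj1 (Some x) xw; have := adj2 (Some x) xw.
have := adj1 (Some y) yw; have := adj2 (Some y) yw.
rewrite /= !(inj_eq Some_inj) !eqxx (negPf xy) (negPf yx) !arc_value_diag => Y2 Y1 X2 X1 E2 E1.
have {}Y2 : arc_value w (Some y) (x, ~~ b) = 1 - bsign par * bsign b by lia.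
have {}Y1 : arc_value w (Some y) (x, b) = 1 - bsign (~~ b) by lia.
rewrite !(@pair_termE _ _ x b) (@pair_termE _ _ y (~~ b)) (@pair_termE _ _ y (~~ b)).
rewrite (@pair_termE _ _ y (~~ b)) negbK !arc_value_diag X1 X2 Y1 Y2 E1 E2.
rewrite /arc_value; case: par {ew' adj2 X2 Y2 E2};
  case: b {ew adj1 X1 Y1 E1}; rewrite /bsign /=; ring.
Qed.

(** * Local moves on words *)

Lemma swap_diff_out (S : word) (e : option nat) (p : letter) :
  p \notin S -> swap_diff S e p = 0.
Proof.
case: S => [|a [|b [|]]] //; rewrite !inE negb_or => /andP[/negPf pa /negPf pb].
by rewrite /swap_diff pa pb !andbF !mulr0.
Qed.

Lemma local_move_perm (T T' : seq word) (w w' : word) :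
  size T = size T' -> local_move T T' w w' ->
  exists q us, [/\ size q = size us, {subset q <= zip T T'}, perm_eq (unzip1 q) T,
    perm_eq (unzip2 q) T' & w = glue (unzip1 q) us /\ w' = glue (unzip2 q) us].
Proof.
move=> sT [q [us [pq su ew ew']]]; exists q, us; split=> //.
- by move=> s; rewrite (perm_mem pq).
- by rewrite -[X in perm_eq _ X](@unzip1_zip _ _ T T') ?sT // perm_map.
- by rewrite -[X in perm_eq _ X](@unzip2_zip _ _ T T') ?sT // perm_map.
Qed.

Lemma local_move_infix (T T' : seq word) (w w' : word) (S : word) :
  size T = size T' -> local_move T T' w w' ->
  S \in T -> exists u v, w = u ++ S ++ v.
Proof.
move=> sT mv ST; have [q [us [su _ p1 _ [-> _]]]] := local_move_perm sT mv.
by apply: glue_infix; rewrite ?size_map // (perm_mem p1).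
Qed.

Lemma local_move_uniq (T T' : seq word) (w w' : word) :
  size T = size T' -> local_move T T' w w' ->
  uniq w -> uniq (flatten T).
Proof.
move=> sT mv; have [q [us [su _ p1 _ [-> _]]]] := local_move_perm sT mv.
rewrite (perm_uniq (perm_glue _)) ?size_map // cat_uniq => /andP[+ _].
by rewrite (perm_uniq (perm_flatten p1)).
Qed.

(** Deleting letters commutes with gluing, so a move of diagrams remains a local move of strings
    once virtual crossings are removed. *)
Lemma local_move_filter (T T' : seq word) (w w' : word) (P : pred letter) :
  local_move T T' w w' ->
  local_move (map (filter P) T) (map (filter P) T') (filter P w) (filter P w').
Proof.
case=> q [us [pq su ew ew']].
exists [seq (filter P s.1, filter P s.2) | s <- q], (map (filter P) us); split.
- rewrite -[X in perm_eq _ X]/(zip (map _ T) (map _ T')).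
  have -> : zip (map (filter P) T) (map (filter P) T')
      = [seq (filter P s.1, filter P s.2) | s <- zip T T'].
    by elim: (T) (T') => [|S t IH] [|S' t'] //=; rewrite IH.
  exact: perm_map.
- by rewrite !size_map.
- by rewrite ew filter_glue /unzip1 -!map_comp.
- by rewrite ew' filter_glue /unzip2 -!map_comp.
Qed.

Lemma local_move_id (T : seq word) (w w' : word) : local_move T T w w' -> w = w'.
Proof.
move=> /(local_move_perm erefl)[q [us [_ sq _ _ [-> ->]]]].
congr (glue _ us); apply/eq_in_map => s /sq.
by elim: T {sq} => //= S T IH; rewrite inE => /orP[/eqP->|/IH].
Qed.

Lemma local_move_erase (T T' : seq word) (w w' : word) (s : seq nat) :
  size T = size T' -> local_move T T' w w' ->
    uniq w -> all (@nilp letter) T' -> (forall l : letter, (l \in flatten T) = (l.1 \in s)) ->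
  w' = erase s w.
Proof.
move=> sT mv; have [q [us [su _ p1 p2 [-> ->]]]] := local_move_perm sT mv.
rewrite (perm_uniq (perm_glue _)) ?size_map // cat_uniq => /and3P[_ dis _] nT' Ts.
rewrite /erase filter_glue; have -> : map (filter (fun l : letter => l.1 \notin s)) us = us.
  (* Letters occur only once, so the outside arcs share none with the strands and survive the
     erasure intact. *)
  apply: map_id_in => u uin; apply/all_filterP/allP => l lu /=.
  rewrite -Ts -(perm_mem (perm_flatten p1)).
  apply: (hasPn dis); apply/flattenP; by exists u.
congr (glue _ us); transitivity (nseq (size q) ([::] : word)).
  rewrite -(size_map snd); apply/all_pred1P; move: nT'; rewrite -(perm_all _ p2).
  by apply: sub_all => S /nilP ->.
rewrite -(size_map fst) -(size_map (filter (fun l : letter => l.1 \notin s))).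
symmetry; apply/all_pred1P; rewrite all_map; apply/allP => S Sq /=.
rewrite -size_eq0 size_filter -leqn0 leqNgt -has_count; apply/hasPn => l lS.
rewrite negbK -Ts; apply/flattenP; exists S => //.
by rewrite -(perm_mem p1).
Qed.

Lemma local_move_swap (T T' : seq word) (w w' : word) (e : option nat) (p : letter) :
  size T = size T' -> local_move T T' w w' ->
    {in zip T T', forall s, exists a b, [/\ a.1 != b.1, s.1 = [:: a; b] & s.2 = [:: b; a]]} ->
  gauss w -> has_label w e -> p \in w ->
  arc_value w' e p = arc_value w e p + \sum_(S <- T) swap_diff S e p.
Proof.
move=> sT mv Z gw ew pw; have [q [us [su sq p1 p2 [ew1 ew2]]]] := local_move_perm sT mv.
move: ew1 ew2 gw ew pw => -> -> gw ew pw.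
rewrite (@arc_value_glue q us [::]) //; last by move=> s /sq; apply: Z.
by rewrite -(perm_big _ p1) big_map.
Qed.

Lemma local_move_perm_eq (T T' : seq word) (w w' : word) :
  size T = size T' -> local_move T T' w w' ->
  perm_eq (flatten T) (flatten T') -> perm_eq w w'.
Proof.
move=> sT mv pT; have [q [us [su _ p1 p2 [-> ->]]]] := local_move_perm sT mv.
apply: (perm_trans (perm_glue _)); rewrite ?size_map // perm_sym.
apply: (perm_trans (perm_glue _)); rewrite ?size_map // perm_cat2r.
by rewrite (permPl (perm_flatten p2)) perm_sym (permPl (perm_flatten p1)).
Qed.

(** * Triangles *)

Lemma pairing_triangle (w w' : word) (x y z : nat) (o1 o2 o3 : bool) (e f : option nat) :
  gauss w -> local_move (triangle o1 o2 o3 x y z)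
    (triangle (~~ o1) (~~ o2) (~~ o3) x y z) w w' ->
  perm_eq w w' /\ (has_label w e -> has_label w f ->
  pairing w' (arc_value w' e) (arc_value w' f) = pairing w (arc_value w e) (arc_value w f)).
Proof.
move=> gw mv; have [uw _] := andP gw.
have sT : size (triangle o1 o2 o3 x y z) = size (triangle (~~ o1) (~~ o2) (~~ o3) x y z) by [].
have pww : perm_eq w w'.
  apply: (local_move_perm_eq sT mv).
  have ps o l l' : perm_eq (side o l l') (side (~~ o) l l').
    by case: o; rewrite /= (perm_catC [:: _] [:: _]).
  (* Negating all orientations preserves the comparisons between them, so each side keeps its two
     letters and only their order is reversed. *)
  by rewrite /triangle !(inj_eq negb_inj) /= !perm_cat.
split=> // eP fP.
have uT := local_move_uniq sT mv uw.
have inf S := @local_move_infix _ _ _ _ S sT mv.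
have adj S a b c : S \in triangle o1 o2 o3 x y z -> S = [:: a; b] -> has_label w c ->
  arc_value w c b = arc_value w c a
    + bsign a.2 * (c == Some a.1)%:Z + bsign b.2 * (c == Some b.1)%:Z.
  by move=> /inf[u [v ew]] eS cP; rewrite eS in ew; apply: arc_value_adj ew cP.
have mem l : l \in flatten (triangle o1 o2 o3 x y z) -> l.1 \in labels w.
  move=> /flattenP[S /inf[u [v ew]] lS]; apply: labels_mem => //.
  by rewrite ew !mem_cat lS orbT.
(* If two corners had the same label, four distinct letters would share it, while a label has only
   two letters. *)
have [xy xz yz] : [/\ x != y, x != z & y != z].
  move: uT; case: (o1) (o2) (o3) => [] [] [] /=; rewrite !inE !xpair_eqE;
  by case: (eqVneq x y); case: (eqVneq x z); case: (eqVneq y z) => //=; rewrite ?andbF ?orbT.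
have sw c p := @local_move_swap _ _ _ _ c p sT mv.
have {}sw c p : has_label w c -> p \in w ->
    arc_value w' c p = arc_value w c p + \sum_(S <- triangle o1 o2 o3 x y z) swap_diff S c p.
  move=> cP; apply: sw => //.
  move=> s; rewrite /triangle !(inj_eq negb_inj) /= !inE => /or3P[] /eqP -> /=; rewrite /side.
  - case: (o1) => /=; do 2 eexists;
    by (split; last by []; first last; first by []) => //=; rewrite eq_sym.
  - case: (o2) => /=; do 2 eexists;
    by (split; last by []; first last; first by []) => //=; rewrite eq_sym.
  - case: (o3) => /=; do 2 eexists;
    by (split; last by []; first last; first by []) => //=; rewrite eq_sym.
have us : uniq [:: x; y; z] by rewrite /= !inE negb_or xy xz yz.
have sub : {subset [:: x; y; z] <= labels w}.
  move=> c; rewrite !inE => /or3P[] /eqP ->.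
  - apply: (mem (x, o1 == o2)); case: (o1) (o2) (o3) => [] [] [] /=;
    by rewrite !inE !xpair_eqE !eqxx ?orbT.
  - apply: (mem (y, o2 == o3)); case: (o1) (o2) (o3) => [] [] [] /=;
    by rewrite !inE !xpair_eqE !eqxx ?orbT.
  - apply: (mem (z, o3 == o1)); case: (o1) (o2) (o3) => [] [] [] /=;
    by rewrite !inE !xpair_eqE !eqxx ?orbT.
have -> A B : pairing w' A B = pairing w A B by apply: perm_big; rewrite perm_sym labels_perm.
rewrite !(@pairing_erase [:: x; y; z] w) //; congr (_ + _); last first.
  apply: eq_big_seq => c; rewrite mem_labels_erase !inE !negb_or.
  case/andP => /and3P[cx cy cz] cw; rewrite /pair_term.
  have V d b : has_label w d -> arc_value w' d (c, b) = arc_value w d (c, b).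
    move=> dP; rewrite sw ?mem_labels // !big_cons big_nil.
    rewrite !swap_diff_out ?addr0 // /triangle /side;
    by case: ifP => _; rewrite !inE !xpair_eqE ?(negPf cx) ?(negPf cy) ?(negPf cz).
  by rewrite !V.
have {}sw c d b : has_label w d -> c \in [:: x; y; z] -> arc_value w' d (c, b)
    = arc_value w d (c, b) + \sum_(S <- triangle o1 o2 o3 x y z) swap_diff S d (c, b).
  by move=> dP /sub cw; apply: sw; rewrite ?mem_labels.
rewrite !big_cons !big_nil /pair_term !sw ?inE ?eqxx ?orbT // !big_cons !big_nil.
have yx : y != x by rewrite eq_sym.
have zx : z != x by rewrite eq_sym.
have zy : z != y by rewrite eq_sym.
(* A side run in the opposite direction has the opposite jump, whence the factor [bsign o]. *)
have A o l l' c : side o l l' \in triangle o1 o2 o3 x y z -> has_label w c ->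
    arc_value w c l' = arc_value w c l + bsign o
      * (bsign l.2 * (c == Some l.1)%:Z + bsign l'.2 * (c == Some l'.1)%:Z).
  case: o => /= /adj H cP; rewrite (H _ _ _ erefl cP) /bsign; ring.
have A1 c (cP : has_label w c) := A o1 _ _ c (mem_head _ _) cP.
have A2 c (cP : has_label w c) :=
  A o2 (x, o1 != o2) (y, o2 == o3) c ltac:(by rewrite !inE eqxx orbT) cP.
have A3 c (cP : has_label w c) :=
  A o3 (y, o2 != o3) (z, o3 == o1) c ltac:(by rewrite !inE eqxx !orbT) cP.
(* Adjacency eliminates one of the two values on each side. The tests whether [e] or [f] is a corner
   stay as free variables for [ring], so arrows at the corners are included. *)
move: (A1 e eP) (A1 f fP) (A2 e eP) (A2 f fP) (A3 e eP) (A3 f fP).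
clear -xy xz yz yx zx zy; rewrite /swap_diff /bsign.
case: o1 o2 o3 => [] [] [] /= -> -> -> -> -> ->;
rewrite !xpair_eqE !eqxx ?(negPf xy, negPf xz, negPf yz, negPf yx, negPf zx, negPf zy) /= ?andbT ?andbF;
rewrite -[Posz 0]/(0 : int).
all: ring.
Qed.

(** * Effect of diagram moves on strings and matrices *)

Lemma real_word_marks (D D' : diagram) :
  virt D =1 virt D' -> real_word D' = [seq l <- dword D' | ~~ virt D l.1].
Proof. by move=> ev; apply: eq_filter => l; rewrite ev. Qed.

Lemma real_word_move (D D' : diagram) (T T' : seq word) :
  virt D =1 virt D' -> local_move T T' (dword D) (dword D') ->
  local_move (map (filter (fun l : letter => ~~ virt D l.1)) T)
    (map (filter (fun l : letter => ~~ virt D l.1)) T') (real_word D) (real_word D').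
Proof. by move=> ev mv; rewrite (real_word_marks ev); apply: local_move_filter. Qed.

Lemma sbm_iso_same_word (a a' : svstring) :
  sword a' = sword a -> pref a' = pref a -> sbm_iso (sbm_of a) (sbm_of a').
Proof.
move=> ew ep; apply: svstring_iso_sbm; exists id => //; split=> //.
by exists 0; rewrite rot0 map_id_in // => -[].
Qed.

(** For moves whose two sides carry the same non-virtual letters on each strand: the string itself
    does not change. *)
Lemma virtual_move_iso (D D' : diagram) (T T' : seq word) :
  same_marks D D' ->
  map (filter (fun l : letter => ~~ virt D l.1)) T
    = map (filter (fun l : letter => ~~ virt D l.1)) T' ->
  local_move T T' (dword D) (dword D') ->
  sbm_iso (sbm_of (string_of D)) (sbm_of (string_of D')).
Proof.
case=> ev ed eT mv; apply: sbm_iso_same_word => //=.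
by have := real_word_move ev mv; rewrite eT => /local_move_id.
Qed.

Lemma renamed_filter (f : nat -> nat) (w w' : word) (P P' : pred letter) :
  gauss w -> renamed f w w' -> {in w, forall l, P' (relabel f l) = P l} ->
  renamed f (filter P w) (filter P' w').
Proof.
move=> gw [fi [k ->]] PP'; split.
  move=> c d /mapP[l + ->] /mapP[l' + ->].
  rewrite !mem_filter => /and3P[_ _ lw] /and3P[_ _ lw'].
  by apply: fi; apply: labels_mem.
(* After filtering, the base point moves by the number of letters kept among the first [k]. *)
exists (size (filter P (take k w))); rewrite /rot !filter_cat -map_drop -map_take.
have E (s : word) : {subset s <= w} ->
    filter P' (map (relabel f) s) = map (relabel f) (filter P s).
  by move=> sw; rewrite filter_map (@eq_in_filter _ _ P) // => l /sw /PP'.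
rewrite !E; [|exact: mem_take|exact: mem_drop].
have -> : filter P w = filter P (take k w) ++ filter P (drop k w).
  by rewrite -filter_cat cat_take_drop.
by rewrite map_cat -(size_map (relabel f)) drop_size_cat // take_size_cat.
Qed.

Lemma singularity_switch_string (a a' : svstring) :
  sword a' = sword a -> pref a' != pref a ->
  (forall e, has_label (sword a) e ->
    pairing (sword a) (arc_value (sword a) (Some (pref a'))) (arc_value (sword a) e)
    + pairing (sword a) (arc_value (sword a) (Some (pref a))) (arc_value (sword a) e)
    = pairing (sword a) (arc_value (sword a) None) (arc_value (sword a) e)) ->
  singularity_switch (sbm_of a) (sbm_of a').
Proof.
(* Identifying the two words gives both matrices the same underlying set, so the identity is the
   required bijection. *)
case: a a' => w p gw pw [w' p' gw' pw'] /= ew; case: w' / {ew}(esym ew) gw' pw' => gw' pw' pp' sum.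
set a := SVString gw pw.
exists id, (Some (SeqSub pw') : sbm_of a); split=> //.
- by exists id.
move=> h; have := sb_pairing (Some (SeqSub pw') : sbm_of a) h.
have := sb_pairing (sd (sbm_of a)) h; have := sb_pairing (ss (sbm_of a)) h.
have := sum _ (has_labelP h); rewrite /=.
by move=> E1 E2 E3 E4; lia.
Qed.

Lemma flat_neq_dbl (D : diagram) (x : nat) : flat D x -> x != dbl D.
Proof. by case/andP. Qed.

Lemma flat_nvirt (D : diagram) (x : nat) : flat D x -> virt D x = false.
Proof. by case/andP => /negPf. Qed.

Lemma has_label_erase (s : seq nat) (w : word) (e : option nat) (x : nat) :
  has_label (erase s w) e -> x \in s -> has_label w e /\ (e == Some x) = false.
Proof.
case: e => //= c; rewrite mem_labels_erase => /andP[cs ->] xs; split=> //.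
by rewrite (inj_eq Some_inj); apply: contraNF cs => /eqP ->.
Qed.

Lemma pair_term_kink (s : seq nat) (w u v : word) (x : nat) (b : bool) (e f : option nat) :
  gauss w -> w = u ++ [:: (x, b), (x, ~~ b) & v] -> x \in s ->
  has_label (erase s w) e -> has_label (erase s w) f ->
  pair_term (arc_value w e) (arc_value w f) x = 0.
Proof.
move=> gw ew xs eP fP.
have [eP' ex] := has_label_erase eP xs; have [fP' fx] := has_label_erase fP xs.
rewrite (pair_termE _ _ _ b) !(arc_value_adj gw ew) //= ex fx !mulr0 !addr0.
by rewrite mulrC subrr mul0r.
Qed.

(** The arc function of a surviving arrow is constant along each side of the bigon, and each side
    joins a tail to a head. Passing from [x] to [y] thus exchanges tail and head values and changes
    the sign of the term. *)
Lemma pair_term_bigon (w u v u' v' : word) (x y : nat) (b par : bool) (e f : option nat) :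
  gauss w -> w = u ++ [:: (x, b), (y, ~~ b) & v] ->
  w = u' ++ nth [::] (bigon x y b par) 1 ++ v' ->
  has_label (erase [:: x; y] w) e -> has_label (erase [:: x; y] w) f ->
  pair_term (arc_value w e) (arc_value w f) x
  + pair_term (arc_value w e) (arc_value w f) y = 0.
Proof.
move=> gw ew ew' eP fP.
have V c : has_label (erase [:: x; y] w) c -> arc_value w c (y, ~~ b) = arc_value w c (x, b)
    /\ arc_value w c (y, b) = arc_value w c (x, ~~ b).
  move=> cP; have [cP' cx] := has_label_erase cP (mem_head _ _).
  have [_ cy] := has_label_erase cP (mem_last x [:: y]); rewrite /= in cy.
  split; first by rewrite (arc_value_adj gw ew) //= cx cy !mulr0 !addr0.
  case: par ew' => ew'.
    by rewrite (arc_value_adj gw ew') //= cx cy !mulr0 !addr0.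
  by rewrite (arc_value_adj gw ew') //= cx cy !mulr0 !addr0.
have [e1 e2] := V e eP; have [f1 f2] := V f fP.
rewrite (pair_termE _ _ x b) (pair_termE _ _ y (~~ b)) negbK e1 e2 f1 f2.
by rewrite /bsign; case: (b) => /=; ring.
Qed.

(** Read from [D'] to [D], since the matrix moves add elements whereas the diagram move removes
    crossings. *)
Lemma homologous_kink_move (D D' : diagram) (x y : nat) (b c : bool) :
  same_marks D D' -> flat D x -> flat D y ->
  local_move [:: kink x b ++ kink y c] [:: [::]] (dword D) (dword D') ->
  homologous (sbm_of (string_of D')) (sbm_of (string_of D)).
Proof.
move=> [ev ed] fx fy; set T := [:: kink x b ++ _]; set T' := [:: [::]] => mv.
have sT : size T = size T' by [].
have {}mv : local_move T T' (real_word D) (real_word D').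
  by have := real_word_move ev mv; rewrite /= (flat_nvirt fx) (flat_nvirt fy).
set a := string_of D; set a' := string_of D'.
have gw : gauss (sword a) := sword_gauss a.
have [uw _] := andP gw.
have [u [v ew]] := local_move_infix sT mv (mem_head _ _).
have xy : x != y.
  have := local_move_uniq sT mv uw; rewrite /T /= !inE !xpair_eqE.
  by case: (eqVneq x y) => // _; rewrite ?eqxx; case: (b) (c) => [] [].
have xw : x \in labels (sword a).
  by apply: (@labels_mem _ (x, b)); rewrite //= ew !mem_cat !inE eqxx ?orbT.
have yw : y \in labels (sword a).
  by apply: (@labels_mem _ (y, c)); rewrite //= ew !mem_cat !inE eqxx ?orbT.
have [X eX] := label_ex (e := Some x) xw; have [Y eY] := label_ex (e := Some y) yw.
have ewx : sword a = u ++ [:: (x, b), (x, ~~ b) & [:: (y, c); (y, ~~ c)] ++ v] by [].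
have ewy : sword a = (u ++ [:: (x, b); (x, ~~ b)]) ++ [:: (y, c), (y, ~~ c) & v].
  by rewrite -catA.
have er : sword a' = erase [:: x; y] (sword a).
  apply: (local_move_erase sT mv) => //= -[d o].
  by rewrite !inE !xpair_eqE /=; case: (d == x); case: (d == y); case: (b) (c) (o) => [] [] [].
apply: (@homologous_adds_kinks _ _ X Y).
- apply: (adds_two_erase xy) => // e f; rewrite er => eP fP.
  by rewrite (pair_term_kink gw ewx _ eP fP) ?(pair_term_kink gw ewy _ eP fP) // !inE eqxx ?orbT.
- exact: kink_element ewx eX (flat_neq_dbl fx).
- exact: kink_element ewy eY (flat_neq_dbl fy).
Qed.

Lemma homologous_bigon_move (D D' : diagram) (x y : nat) (b par : bool) :
  same_marks D D' -> flat D x -> flat D y ->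
  local_move (bigon x y b par) [:: [::]; [::]] (dword D) (dword D') ->
  homologous (sbm_of (string_of D')) (sbm_of (string_of D)).
Proof.
move=> [ev ed] fx fy; set T := bigon _ _ _ _; set T' := [:: [::]; [::]] => mv.
have sT : size T = size T' by [].
have {}mv : local_move T T' (real_word D) (real_word D').
  have := real_word_move ev mv; rewrite /T /= (flat_nvirt fx) (flat_nvirt fy) /=.
  by case: (par); rewrite /= (flat_nvirt fx) (flat_nvirt fy).
set a := string_of D; set a' := string_of D'.
have gw : gauss (sword a) := sword_gauss a.
have [uw _] := andP gw.
have [u [v ew]] := local_move_infix sT mv (mem_head _ _).
have [u' [v' ew']] := local_move_infix sT mv (mem_nth [::] (isT : (1 < size T)%N)).
have xy : x != y.
  have := local_move_uniq sT mv uw; rewrite /T /=.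
  by case: (par); rewrite /= !inE !xpair_eqE; case: (eqVneq x y) => // _; rewrite ?eqxx; case: (b).
have xw : x \in labels (sword a).
  by apply: (@labels_mem _ (x, b)); rewrite //= ew !mem_cat !inE eqxx ?orbT.
have yw : y \in labels (sword a).
  by apply: (@labels_mem _ (y, ~~ b)); rewrite //= ew !mem_cat !inE eqxx ?orbT.
have [X eX] := label_ex (e := Some x) xw; have [Y eY] := label_ex (e := Some y) yw.
have er : sword a' = erase [:: x; y] (sword a).
  apply: (local_move_erase sT mv) => //= -[d o].
  case: (par); rewrite !inE !xpair_eqE /=;
  by case: (d == x); case: (d == y); case: (b) (o) => [] [].
apply/rst_step/MoveM3; exists X, Y; split.
  apply: (adds_two_erase xy) => // e f; rewrite er => eP fP.
  exact: pair_term_bigon gw ew ew' eP fP.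
have fr (Z : sbm_of a) z : label Z = Some z -> flat D z -> is_free Z.
  move=> eZ fz; rewrite /is_free -!(inj_eq (@label_inj a)) eZ /= (inj_eq Some_inj).
  exact: flat_neq_dbl.
split; [exact: fr eX fx | exact: fr eY fy | move=> h].
have := pairing_bigon gw xy ew ew' (has_labelP h).
have := sb_pairing X h; have := sb_pairing Y h; have := sb_pairing (ss (sbm_of a)) h.
by rewrite eX eY => E1 E2 E3 E4; move: E1 E2 E3 E4 => /=; lia.
Qed.

(** * Homotopy invariance *)

Lemma move_homologous (D D' : diagram) :
  move D D' -> homologous (sbm_of (string_of D)) (sbm_of (string_of D')).
Proof.
case=> [f ren ev ed|x b mk vx mv|x y b c mk fx fy mv|x y b par mk vx vy mv
  |x y b par mk fx fy mv|x y z o1 o2 o3 mk vy vz mv|x y z o1 o2 o3 mk vx fy fz mv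
  |y b par ev fy ed ew mv].
- apply/homologous_iso/svstring_iso_sbm; exists f => //=.
  apply: renamed_filter ren _; first exact: dword_gauss.
  by move=> l lw /=; rewrite ev // labels_mem // dword_gauss.
- by apply/homologous_iso/(virtual_move_iso mk _ mv) => //=; rewrite vx.
- by apply: rst_sym; apply: homologous_kink_move mk fx fy mv.
- apply/homologous_iso/(virtual_move_iso mk _ mv) => //=; rewrite vx vy /=.
  by case: (par); rewrite /= vx vy.
- by apply: rst_sym; apply: homologous_bigon_move mk fx fy mv.
- apply/homologous_iso/(virtual_move_iso mk _ mv) => //=.
  (* Strand 3 loses both letters; strands 1 and 2 keep at most their letter of [x], so the order on
     them no longer matters. *)
  by rewrite /side; case: (o1) (o2) (o3) => [] [] [] /=; rewrite ?vy ?vz //=; case: (virt D x).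
(* Here [x] may be the double point. The identity on labels is an isomorphism and keeps the
   preferred arrow. *)
- apply: homologous_iso; have [evm edm] := mk.
  have gw := real_word_gauss D.
  have {}mv : local_move (triangle o1 o2 o3 x y z)
      (triangle (~~ o1) (~~ o2) (~~ o3) x y z) (real_word D) (real_word D').
    have := real_word_move evm mv.
    by rewrite /side; case: (o1) (o2) (o3) => [] [] [] /=;
      rewrite /= ?(flat_nvirt fy) ?(flat_nvirt fz) ?vx.
  have [pw _] := pairing_triangle None None gw mv.
  have lw := labels_perm pw.
  apply: (@sbm_iso_relabel _ _ id) => //=; first by apply: perm_size.
    by move=> c; rewrite (perm_mem lw).
  move=> e e' eP eP'; rewrite !omap_id.
  by have [_ ->] := pairing_triangle e e' gw mv.
(* For the double point flip, the bigon relation between [dbl D] and [y] is the condition of the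
   singularity switch. *)
have er : real_word D' = real_word D by rewrite (real_word_marks ev) ew.
set T := bigon _ _ _ _ in mv.
have mvr : local_move T T (real_word D) (real_word D').
  have := real_word_move ev mv; rewrite /T /= (flat_nvirt fy) (negPf (dbl_nvirt D)) /=.
  by case: (par); rewrite /= (flat_nvirt fy) (negPf (dbl_nvirt D)).
have gw := real_word_gauss D.
have [u [v eu]] := local_move_infix erefl mvr (mem_head _ _).
have [u' [v' eu']] := local_move_infix erefl mvr (mem_nth [::] (isT : (1 < size T)%N)).
have dy : dbl D != y by rewrite eq_sym flat_neq_dbl.
apply/rst_step/MoveN/singularity_switch_string => //=.
  by rewrite ed eq_sym.
by move=> e eP; rewrite ed addrC; apply: (pairing_bigon gw dy eu eu' eP).
Qed.

Theorem theorem28 (alpha beta : svstring) :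
  homotopic alpha beta -> homologous (sbm_of alpha) (sbm_of beta).
Proof.
case=> D [D' [iD iD' rel]].
apply: (@rst_trans _ _ _ (sbm_of (string_of D))).
  exact/rst_sym/homologous_iso/svstring_iso_sbm.
apply: (@rst_trans _ _ _ (sbm_of (string_of D'))); last first.
  exact/homologous_iso/svstring_iso_sbm.
elim: rel => [E E' /move_homologous //|E|E E' _|E E' E'' _ IH _].
- exact: rst_refl.
- exact: rst_sym.
exact: rst_trans.
Qed.
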